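(* Consider the bilevel polynomial problem $(P)$ described in the context, and suppose that its lower level problem is convex. Suppose that there exist $R_1,R_2>0$, sums-of-squares polynomials $\sigma_0,\ldots,\sigma_s\in\Sigma^2[x,y]$ and sums-of-squares polynomials $\bar\sigma_0,\ldots,\bar\sigma_r\in\Sigma^2[y]$ such that $$R_1-\|(x,y)\|^2=\sigma_0(x,y)-\sum_{i=1}^s\sigma_i(x,y)g_i(x,y),\qquad R_2-\|y\|^2=\bar\sigma_0(y)-\sum_{j=1}^r\bar\sigma_j(y)h_j(y).$$ Suppose also that the lower level problem satisfies both the nondegeneracy condition and the Slater condition. For $k\in\mathbb{N}$ let $(Q_k)$ be the sums-of-squares relaxation defined in the context. Then $\mathrm{val}(Q_k)\le\mathrm{val}(Q_{k+1})$ for all $k\in\mathbb{N}$, and $\mathrm{val}(Q_k)\to\mathrm{val}(P)$ as $k\to\infty$.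
   Context: The bilevel polynomial optimization problem is $$(P)\quad \min_{x\in\mathbb{R}^n,\,y\in\mathbb{R}^m} f(x,y)\ \text{ subject to }\ g_i(x,y)\le 0,\ i=1,\ldots,s,\quad y\in Y(x):=\mathrm{argmin}_{w\in\mathbb{R}^m}\{G(x,w): h_j(w)\le 0,\ j=1,\ldots,r\},$$ where $f,g_i,G:\mathbb{R}^n\times\mathbb{R}^m\to\mathbb{R}$ and $h_j:\mathbb{R}^m\to\mathbb{R}$ are polynomials with real coefficients. Standing assumption: the feasible set $\{(x,y): g_i(x,y)\le 0,\ i=1,\ldots,s,\ y\in Y(x)\}$ of $(P)$ is nonempty. The lower level problem is convex if for each $x\in\mathbb{R}^n$ the polynomial $G(x,\cdot)$ is convex on $\mathbb{R}^m$ and the set $F:=\{w\in\mathbb{R}^m: h_j(w)\le 0,\ j=1,\ldots,r\}$ is convex (the $h_j$ themselves need not be convex). Nondegeneracy condition: for each $j=1,\ldots,r$, if $y\in F$ and $h_j(y)=0$ then $\nabla h_j(y)\ne 0$. Slater condition: there exists $y_0\in\mathbb{R}^m$ with $h_j(y_0)<0$ for all $j=1,\ldots,r$. A real polynomial is a sum of squares if it is a finite sum of squares of real polynomials; $\Sigma^2[\cdot]$ is the set of sums-of-squares polynomials in the indicated variables. For $\lambda=(\lambda_0,\ldots,\lambda_r)\in\mathbb{R}^{r+1}$ define the polynomials $$\widehat G_p(x,y,\lambda)=\begin{cases} g_p(x,y), & p=1,\ldots,s,\\ h_{p-s}(y), & p=s+1,\ldots,s+r,\\ -\lambda_{p-(s+r+1)},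 & p=s+r+1,\ldots,s+2r+1,\end{cases}$$ $$\widehat H_q(x,y,\lambda)=\begin{cases}\lambda_qh_q(y), & q=1,\ldots,r,\\ \big(\lambda_0\nabla_yG(x,y)+\sum_{j=1}^r\lambda_j\nabla h_j(y)\big)_{q-r}, & q=r+1,\ldots,r+m,\\ \sum_{j=0}^r\lambda_j^2-1, & q=r+m+1,\end{cases}$$ where $(\cdot)_i$ denotes the $i$th coordinate and $\nabla_yG$ the gradient of $G$ in its second variable. For each $k\in\mathbb{N}$, $(Q_k)$ is the problem of maximizing $\mu\in\mathbb{R}$ subject to $$f-\mu=\sigma_0-\sum_{p=1}^{s+2r+1}\sigma_p\widehat G_p-\sum_{q=1}^{r+m+1}\phi_q\widehat H_q,$$ with $\sigma_p\in\Sigma^2[x,y,\lambda]$ for $p=0,1,\ldots,s+2r+1$, $\phi_q\in\mathbb{R}[x,y,\lambda]$ for $q=1,\ldots,r+m+1$, $\deg\sigma_0\le 2k$, $\deg(\sigma_p\widehat G_p)\le 2k$ for $p=1,\ldots,s+2r+1$, and $\deg(\phi_q\widehat H_q)\le 2k$ for $q=1,\ldots,r+m+1$. $\mathrm{val}(\cdot)$ denotes the optimal value; for $(Q_k)$ this is the supremum of feasible $\mu$, equal to $-\infty$ if $(Q_k)$ is infeasible. *)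

(* Defs.v *)
From HB Require Import structures.
From mathcomp Require Import all_boot all_order all_algebra.
(* The notations of mpoly clash with those of mathcomp-analysis. *)
From mathcomp Require Import -(notations) mpoly.
From mathcomp Require Import boolp classical_sets functions reals ereal.
From mathcomp Require Import topology normedtype sequences convex.

Set Implicit Arguments.
Unset Strict Implicit.
Unset Printing Implicit Defensive.

Import Order.TTheory GRing.Theory Num.Theory.
Import numFieldNormedType.Exports.

Local Open Scope classical_set_scope.
Local Open Scope ring_scope.

Notation "{ 'mpoly' T [ n ] }" := (mpoly n T).

Definition mvar (R : realType) (n : nat) (i : 'I_n) : {mpoly R[n]} :=
  mpolyX R (mnm1 i).

Definition peval (R : realType) (n : nat) (p : {mpoly R[n]}) (v : 'rV[R]_n) : R :=
  meval (v ord0) p.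

Definition gradient (R : realType) (n : nat) (p : {mpoly R[n]}) (v : 'rV[R]_n) :
    'rV[R]_n :=
  \row_(i < n) peval (mderiv i p) v.

(* mmeasure mdeg is the degree plus one, and 0 for the zero polynomial, which thus has
   degree at most d for every d. *)
Definition deg_le (R : realType) (n : nat) (p : {mpoly R[n]}) (d : nat) : Prop :=
  (mmeasure mdeg p <= d.+1)%N.

Definition sos (R : realType) (n : nat) (p : {mpoly R[n]}) : Prop :=
  exists s : seq {mpoly R[n]}, p = \sum_(q <- s) q ^+ 2.

Definition sqnorm (R : realType) (n : nat) : {mpoly R[n]} :=
  \sum_(i < n) mvar R i ^+ 2.

Definition rename (R : realType) (n k : nat) (e : 'I_n -> 'I_k)
    (p : {mpoly R[n]}) : {mpoly R[k]} :=
  comp_mpoly [tuple mvar R (e i) | i < n] p.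

(* R[x,y] is {mpoly R[n + m]} and R[x,y,lambda] is {mpoly R[n + m + r.+1]}. *)
Definition of_xy (R : realType) (n m r : nat) (p : {mpoly R[n + m]}) :
    {mpoly R[n + m + r.+1]} :=
  rename (@lshift (n + m) r.+1) p.

Definition of_y (R : realType) (n m r : nat) (p : {mpoly R[m]}) :
    {mpoly R[n + m + r.+1]} :=
  rename (fun i => lshift r.+1 (rshift n i)) p.

Definition lambda (R : realType) (n m r : nat) (j : 'I_r.+1) :
    {mpoly R[n + m + r.+1]} :=
  mvar R (rshift (n + m) j).

Definition lower_feasible (R : realType) (m r : nat) (h : 'I_r -> {mpoly R[m]}) :
    set 'rV[R]_m :=
  [set w | forall j, peval (h j) w <= 0].

Definition lower_solutions (R : realType) (n m r : nat) (G : {mpoly R[n + m]})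
    (h : 'I_r -> {mpoly R[m]}) (x : 'rV[R]_n) : set 'rV[R]_m :=
  [set y | lower_feasible h y /\
    forall w, lower_feasible h w -> peval G (row_mx x y) <= peval G (row_mx x w)].

Definition bilevel_feasible (R : realType) (n m s r : nat)
    (g : 'I_s -> {mpoly R[n + m]}) (G : {mpoly R[n + m]})
    (h : 'I_r -> {mpoly R[m]}) : set ('rV[R]_n * 'rV[R]_m) :=
  [set z | (forall i, peval (g i) (row_mx z.1 z.2) <= 0) /\
    lower_solutions G h z.1 z.2].

Definition val_P (R : realType) (n m s r : nat) (f : {mpoly R[n + m]})
    (g : 'I_s -> {mpoly R[n + m]}) (G : {mpoly R[n + m]})
    (h : 'I_r -> {mpoly R[m]}) : \bar R :=
  ereal_inf [set (peval f (row_mx z.1 z.2))%:E | z in bilevel_feasible g G h].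

Definition lower_convex (R : realType) (n m r : nat) (G : {mpoly R[n + m]})
    (h : 'I_r -> {mpoly R[m]}) : Prop :=
  (forall x : 'rV[R]_n,
     convex_function [set: 'rV[R]_m] (fun w => peval G (row_mx x w))) /\
  convex_set (lower_feasible h).

Definition nondegeneracy_condition (R : realType) (m r : nat)
    (h : 'I_r -> {mpoly R[m]}) : Prop :=
  forall (j : 'I_r) (y : 'rV[R]_m),
    lower_feasible h y -> peval (h j) y = 0 -> gradient (h j) y <> 0.

Definition slater_condition (R : realType) (m r : nat)
    (h : 'I_r -> {mpoly R[m]}) : Prop :=
  exists y0 : 'rV[R]_m, forall j, peval (h j) y0 < 0.

Definition Ghat (R : realType) (n m s r : nat) (g : 'I_s -> {mpoly R[n + m]})
    (h : 'I_r -> {mpoly R[m]}) (p : 'I_(s + r + r.+1)) :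
    {mpoly R[n + m + r.+1]} :=
  match fintype.split p with
  | inl p' => match fintype.split p' with
              | inl i => of_xy r (g i)
              | inr j => of_y n r (h j)
              end
  | inr j => - lambda R n m j
  end.

(* With j : 'I_r numbered from 0, the multiplier of h j is lambda (lift ord0 j),
   lambda ord0 being the multiplier of G. *)
Definition Hhat (R : realType) (n m r : nat) (G : {mpoly R[n + m]})
    (h : 'I_r -> {mpoly R[m]}) (q : 'I_(r + m + 1)) :
    {mpoly R[n + m + r.+1]} :=
  match fintype.split q with
  | inl q' =>
      match fintype.split q' with
      | inl j => lambda R n m (lift ord0 j) * of_y n r (h j)
      | inr i => lambda R n m ord0 * of_xy r (mderiv (rshift n i) G) +
          \sum_(j < r) lambda R n m (lift ord0 j) *
                       of_y n r (mderiv i (h j))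
      end
  | inr _ => \sum_(j < r.+1) lambda R n m j ^+ 2 - 1
  end.

Definition Q_feasible (R : realType) (n m s r : nat) (f : {mpoly R[n + m]})
    (g : 'I_s -> {mpoly R[n + m]}) (G : {mpoly R[n + m]})
    (h : 'I_r -> {mpoly R[m]}) (k : nat) : set R :=
  [set mu | exists (sigma0 : {mpoly R[n + m + r.+1]})
      (sigma : 'I_(s + r + r.+1) -> {mpoly R[n + m + r.+1]})
      (phi : 'I_(r + m + 1) -> {mpoly R[n + m + r.+1]}),
    [/\ of_xy r f - mpolyC (n + m + r.+1) mu =
          sigma0 - \sum_p sigma p * Ghat g h p - \sum_q phi q * Hhat G h q,
        sos sigma0 /\ (forall p, sos (sigma p)),
        deg_le sigma0 (2 * k)%N,
        forall p, deg_le (sigma p * Ghat g h p) (2 * k)%N &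
        forall q, deg_le (phi q * Hhat G h q) (2 * k)%N]].

(* ereal_sup set0 = -oo *)
Definition val_Q (R : realType) (n m s r : nat) (f : {mpoly R[n + m]})
    (g : 'I_s -> {mpoly R[n + m]}) (G : {mpoly R[n + m]})
    (h : 'I_r -> {mpoly R[m]}) (k : nat) : \bar R :=
  ereal_sup [set mu%:E | mu in Q_feasible f g G h k].

(* Main.v *)
Require Import Defs.
From HB Require Import structures.
From mathcomp Require Import all_boot all_order all_algebra.
From mathcomp Require Import -(notations) mpoly.
From mathcomp Require Import boolp classical_sets functions reals ereal.
From mathcomp Require Import topology normedtype sequences convex.
From mathcomp Require Import ring lra.

Set Implicit Arguments.
Unset Strict Implicit.
Unset Printing Implicit Defensive.

Import Order.TTheory GRing.Theory Num.Theory.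
Import numFieldNormedType.Exports.

Local Open Scope classical_set_scope.
Local Open Scope ring_scope.

(** The lower level problem is replaced by its Fritz John system. A minimizer y of
    G(x, .) over F always has multipliers on the unit sphere (fritz_john_necessary,
    from Gordan's alternative). Conversely, convexity of F together with the Slater
    and nondegeneracy conditions forces the multiplier of G to be positive, so that
    by convexity of G every solution of the system is a global minimizer
    (fritz_john_sufficient). The bilevel feasible set is therefore the projection of
    the basic closed semialgebraic set K given by the polynomials Ghat and Hhat, and
    the value of the bilevel problem is the infimum of f over K.

    Each relaxation bounds this infimum from below, because its certificate can be
    evaluated at the points of K (val_Q_le). The bound is attained in the limit by
    Putinar's Positivstellensatz (putinar): the given representation of
    R1 - |(x, y)|^2 and the equation |lambda|^2 = 1 make the quadratic module of K
    archimedean (hat_archimedean), so f - mu belongs to it for every mu below the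
    infimum, and any one certificate has bounded degrees. Enlarging k enlarges the
    set of certificates, so the values increase to their supremum.

    The Positivstellensatz is derived algebraically, for a quadratic module Q in a
    commutative algebra A over the reals (archimedean_positive_mem). If
    adjoining - f to Q gives a proper quadratic module, Zorn's lemma extends it to a
    maximal one, for which every element of A is infinitely close to exactly one
    constant. The resulting map A -> R is a homomorphism that is nonnegative on Q
    and not positive at f; for polynomials it is the evaluation at a point of K,
    which contradicts the positivity of f on K.
    If adjoining - f is improper, there is an identity s f = 1 + q with s a sum of
    squares and q in Q, and an elementary computation (lower_constant) uses it to
    lower the constant x in f + x until f itself lies in Q. *)

(* Kept folded, so that it is recognized as a ring morphism. *)
Local Notation "c %:A" := (in_alg _ c) : ring_scope.
Local Arguments GRing.in_alg : simpl never.

(** * Archimedean quadratic modules *)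

Definition quadratic_module (R : realType) (A : comAlgType R) (Q : set A) : Prop :=
  [/\ Q 1, forall a b, Q a -> Q b -> Q (a + b) &
      forall a b, Q b -> Q (a ^+ 2 * b)].

Definition archimedean (R : realType) (A : comAlgType R) (Q : set A) : Prop :=
  forall a, exists c : R, Q (c%:A - a).

Lemma qm_scale (R : realType) (A : comAlgType R) (Q : set A) (c : R) (a : A) :
  quadratic_module Q -> 0 <= c -> Q a -> Q (c%:A * a).
Proof.
move=> [_ _ QM] c0 Qa; have := QM (Num.sqrt c)%:A _ Qa.
by rewrite -rmorphXn /= sqr_sqrtr.
Qed.

Lemma qm_const (R : realType) (A : comAlgType R) (Q : set A) (c : R) :
  quadratic_module Q -> 0 <= c -> Q c%:A.
Proof.
by move=> qmQ c0; rewrite -[c%:A]mulr1; apply: qm_scale => //; case: qmQ.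
Qed.

Lemma qm0 (R : realType) (A : comAlgType R) (Q : set A) :
  quadratic_module Q -> Q 0.
Proof. by move=> qmQ; rewrite -(rmorph0 (in_alg A)); apply: qm_const. Qed.

Lemma qm_sum_squares (R : realType) (A : comAlgType R) (Q : set A) (u : seq A)
    (b : A) : quadratic_module Q -> Q b -> Q ((\sum_(a <- u) a ^+ 2) * b).
Proof.
move=> qmQ Qb; rewrite mulr_suml; elim/big_ind: _ => [||a _].
- exact: qm0.
- by case: qmQ.
- by case: qmQ => _ _; apply.
Qed.

Lemma eq_divr_alg (R : realType) (A : comAlgType R) (c : R) (a b : A) :
  c != 0 -> c%:A * a = b -> a = (c^-1)%:A * b.
Proof. by move=> c0 <-; rewrite mulrA -rmorphM /= mulVf // rmorph1 mul1r. Qed.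

(** This is the identity 2 (e - a) = (a - 1)^2 + (c - a^2) for c = 2 e - 1. *)
Lemma bounded_by_square (R : realType) (A : comAlgType R) (Q : set A) (c : R)
    (a : A) : quadratic_module Q -> Q (c%:A - a ^+ 2) -> Q (((c + 1) / 2)%:A - a).
Proof.
move=> qmQ Qc.
set e := (c + 1) / 2; have cE : c = e * 2 - 1 by rewrite /e; field.
have -> : e%:A - a = 2^-1%:A * ((a - 1) ^+ 2 * 1 + (c%:A - a ^+ 2)).
  by apply: eq_divr_alg; rewrite ?pnatr_eq0 // cE; ring.
apply: qm_scale => //.
by case: (qmQ) => Q1 QD QM; apply: QD => //; apply: QM.
Qed.

(** The elements a with c - a^2 in Q for some c >= 0 form a subring:
    (a + b)^2 <= 2 a^2 + 2 b^2, and
    c d - a^2 b^2 = c (d - b^2) + b^2 (c - a^2). *)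
Lemma square_boundedD (R : realType) (A : comAlgType R) (Q : set A) (a b : A) :
  quadratic_module Q ->
  (exists2 c : R, 0 <= c & Q (c%:A - a ^+ 2)) ->
  (exists2 c : R, 0 <= c & Q (c%:A - b ^+ 2)) ->
  exists2 c : R, 0 <= c & Q (c%:A - (a + b) ^+ 2).
Proof.
move=> qmQ [c c0 Qc] [d d0 Qd]; exists (c + c + (d + d)).
  by rewrite !addr_ge0.
have -> : (c + c + (d + d))%:A - (a + b) ^+ 2 =
  (c%:A - a ^+ 2) + (c%:A - a ^+ 2) + ((d%:A - b ^+ 2) + (d%:A - b ^+ 2))
   + (a - b) ^+ 2 * 1 by ring.
by case: (qmQ) => Q1 QD QM; apply/QD; [apply/QD; apply/QD | apply: QM].
Qed.

Lemma square_boundedM (R : realType) (A : comAlgType R) (Q : set A) (a b : A) :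
  quadratic_module Q ->
  (exists2 c : R, 0 <= c & Q (c%:A - a ^+ 2)) ->
  (exists2 c : R, 0 <= c & Q (c%:A - b ^+ 2)) ->
  exists2 c : R, 0 <= c & Q (c%:A - (a * b) ^+ 2).
Proof.
move=> qmQ [c c0 Qc] [d d0 Qd]; exists (c * d); first by rewrite mulr_ge0.
have -> : (c * d)%:A - (a * b) ^+ 2 =
  c%:A * (d%:A - b ^+ 2) + b ^+ 2 * (c%:A - a ^+ 2) by ring.
by case: (qmQ) => Q1 QD QM; apply: QD; [apply: qm_scale | apply: QM].
Qed.

Lemma archimedeanP (R : realType) (A : comAlgType R) (Q : set A) (a : A) :
  quadratic_module Q -> archimedean Q ->
  exists2 c : R, 0 < c & forall d : R, c <= d -> Q (d%:A - a) /\ Q (d%:A + a).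
Proof.
move=> qmQ arQ; have [Q1 QD QM] := qmQ.
have [c Qc] := arQ a; have [d Qd] := arQ (- a).
have up (x y : R) b : x <= y -> Q (x%:A - b) -> Q (y%:A - b).
  move=> xy Qb; have -> : y%:A - b = (y - x)%:A + (x%:A - b) by ring.
  by apply: QD Qb; apply: qm_const; rewrite // subr_ge0.
exists (1 + `|c| + `|d|); first by rewrite -addrA ltr_pwDl // addr_ge0.
move=> e ce; split.
  apply: up Qc; apply: le_trans ce; apply: le_trans (ler_norm _) _.
  by rewrite addrAC lerDr addr_ge0.
rewrite -[a in e%:A + a]opprK; apply: up Qd; apply: le_trans ce.
by apply: le_trans (ler_norm _) _; rewrite lerDr addr_ge0.
Qed.

(** * Maximal quadratic modules and their characters *)

Definition maximal_proper (R : realType) (A : comAlgType R) (Q : set A) : Prop :=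
  [/\ quadratic_module Q, ~ Q (-1) &
      forall Q' : set A, quadratic_module Q' -> ~ Q' (-1) -> Q `<=` Q' -> Q' = Q].

Lemma exists_maximal_proper (R : realType) (A : comAlgType R) (Q0 : set A) :
  quadratic_module Q0 -> ~ Q0 (-1) -> exists2 Q, maximal_proper Q & Q0 `<=` Q.
Proof.
move=> qm0Q nQ0.
(* The empty set is added to the family so that it has a union for the empty
   chain as well. *)
pose P (Q : set A) := Q = set0 \/ [/\ quadratic_module Q, ~ Q (-1) & Q0 `<=` Q].
have [F FP totF|Q [PQ maxQ]] := @Zorn_bigcup _ P.
  have [[Q FQ Qn0]|F0] := pselect (exists2 Q, F Q & Q !=set0); last first.
    left; rewrite -subset0 => a [Q FQ Qa]; apply: F0; exists Q => //; by exists a.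
  have FPne Q' a : F Q' -> Q' a ->
      [/\ quadratic_module Q', ~ Q' (-1) & Q0 `<=` Q'].
    by move=> FQ' Q'a; case: (FP _ FQ') => // e; rewrite e in Q'a.
  have [a0 Qa0] := Qn0; right; split; first split.
  - by exists Q => //; case: (FPne _ _ FQ Qa0) => [[]].
  - move=> a b [Q1 FQ1 Q1a] [Q2 FQ2 Q2b].
    have [s|s] := totF _ _ FQ1 FQ2.
      exists Q2 => //; case: (FPne _ _ FQ2 Q2b) => [[_ QD _] _ _].
      by apply: QD => //; apply: s.
    exists Q1 => //; case: (FPne _ _ FQ1 Q1a) => [[_ QD _] _ _].
    by apply: QD => //; apply: s.
  - move=> a b [Q1 FQ1 Q1b]; exists Q1 => //.
    by case: (FPne _ _ FQ1 Q1b) => [[_ _ QM] _ _]; apply: QM.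
  - by move=> [Q1 FQ1 Q1n]; case: (FPne _ _ FQ1 Q1n).
  - by move=> a Q0a; exists Q => //; case: (FPne _ _ FQ Qa0) => _ _; apply.
have PQ0 : P Q0 by right; split.
case: PQ => [Qe|[qmQ nQ Q0Q]].
  exfalso; apply: (maxQ Q0) PQ0; rewrite Qe properEneq; split; last exact: sub0set.
  by apply/eqP => e; case: qm0Q; rewrite -e.
exists Q => //; split => // Q' qmQ' nQ' QQ'.
apply: contrapT => Q'nQ; apply: (maxQ Q').
  by rewrite properEneq; split => //; apply/eqP => e; apply: Q'nQ.
by right; split => //; apply: subset_trans Q0Q QQ'.
Qed.

(** The quadratic module generated by Q and a. *)
Definition adjoin (R : realType) (A : comAlgType R) (Q : set A) (a : A) : set A :=
  [set b | exists (q : A) (u : seq A), Q q /\ b = q + (\sum_(v <- u) v ^+ 2) * a].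

Lemma adjoin_quadratic_module (R : realType) (A : comAlgType R) (Q : set A) (a : A) :
  quadratic_module Q -> quadratic_module (adjoin Q a).
Proof.
move=> [Q1 QD QM]; split.
- by exists 1, [::]; rewrite big_nil mul0r addr0.
- move=> b c [q [u [Qq ->]]] [q' [u' [Qq' ->]]]; exists (q + q'), (u ++ u').
  by split; [apply: QD | rewrite big_cat /=; ring].
- move=> b c [q [u [Qq ->]]]; exists (b ^+ 2 * q), [seq b * v | v <- u].
  split; first exact: QM.
  rewrite big_map mulrDr mulrA; congr (_ + _ * _).
  by rewrite big_distrr; apply: eq_bigr => v _; rewrite /= exprMn.
Qed.

Lemma sub_adjoin (R : realType) (A : comAlgType R) (Q : set A) (a : A) :
  Q `<=` adjoin Q a.
Proof. by move=> q Qq; exists q, [::]; rewrite big_nil mul0r addr0. Qed.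

Lemma mem_adjoin (R : realType) (A : comAlgType R) (Q : set A) (a : A) :
  quadratic_module Q -> adjoin Q a a.
Proof.
move=> /qm0 Q0; exists 0, [:: 1]; split => //.
by rewrite big_seq1 expr1n mul1r add0r.
Qed.

(** The support Q `&` - Q is an ideal, because 4 a x = (a + 1)^2 x - (a - 1)^2 x. *)
Lemma qm_supportM (R : realType) (A : comAlgType R) (Q : set A) (a x : A) :
  quadratic_module Q -> Q x -> Q (- x) -> Q (a * x).
Proof.
move=> qmQ Qx Qnx; have [Q1 QD QM] := qmQ.
have -> : a * x = 4^-1%:A * ((a + 1) ^+ 2 * x + (a - 1) ^+ 2 * - x).
  by apply: eq_divr_alg; rewrite ?pnatr_eq0 //; ring.
by apply: qm_scale; rewrite // ?invr_ge0//; apply: QD; apply: QM.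
Qed.

(** If neither a nor - a could be adjoined without a contradiction, then
    q1 + s1 a = -1 = q2 - s2 a with s1, s2 sums of squares. Eliminating a gives
    s1 + s2 + s2 q1 + s1 q2 = 0, so s1 lies in the support, and so does s1 a. *)
Lemma maximal_total (R : realType) (A : comAlgType R) (Q : set A) (a : A) :
  maximal_proper Q -> Q a \/ Q (- a).
Proof.
move=> [qmQ nQ maxQ]; have [Q1 QD QM] := qmQ.
have adj b : Q b \/ adjoin Q b (-1).
  have [?|nadj] := pselect (adjoin Q b (-1)); first by right.
  left; rewrite -(maxQ (adjoin Q b)) //; last exact: sub_adjoin.
    exact: mem_adjoin.
  exact: adjoin_quadratic_module.
have [Qa|[q1 [u1 [Qq1 e1]]]] := adj a; first by left.
have [Qna|[q2 [u2 [Qq2 e2]]]] := adj (- a); first by right.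
exfalso; apply: nQ; rewrite e1.
set s1 := \sum_(v <- u1) _ in e1 *; set s2 := \sum_(v <- u2) _ in e2.
have Qs u b : Q b -> Q ((\sum_(v <- u) v ^+ 2) * b) by exact: qm_sum_squares.
apply: (QD) => //; rewrite mulrC; apply: qm_supportM => //.
  by rewrite -[s1]mulr1; apply: Qs.
have -> : - s1 = s2 * 1 + s2 * q1 + s1 * q2.
  have -> : q1 = -1 - s1 * a by rewrite e1; ring.
  have -> : q2 = -1 - s2 * - a by rewrite e2; ring.
  by ring.
by do ! [apply/QD | apply/Qs].
Qed.

Definition infinitesimal (R : realType) (A : comAlgType R) (Q : set A) (a : A) : Prop :=
  forall e : R, 0 < e -> Q (e%:A + a) /\ Q (e%:A - a).

Lemma infinitesimalD (R : realType) (A : comAlgType R) (Q : set A) (a b : A) :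
  quadratic_module Q -> infinitesimal Q a -> infinitesimal Q b ->
  infinitesimal Q (a + b).
Proof.
move=> [_ QD _] ia ib e e0.
have e20 : 0 < e / 2 by rewrite divr_gt0.
have [pa na] := ia _ e20; have [pb nb] := ib _ e20.
have -> : e%:A = (e / 2)%:A + (e / 2)%:A :> A by rewrite -rmorphD /= -splitr.
by split; [have := QD _ _ pa pb | have := QD _ _ na nb]; congr Q; ring.
Qed.

Lemma infinitesimalN (R : realType) (A : comAlgType R) (Q : set A) (a : A) :
  infinitesimal Q a -> infinitesimal Q (- a).
Proof. by move=> ia e e0; have [? ?] := ia _ e0; rewrite opprK. Qed.

Lemma infinitesimalZ (R : realType) (A : comAlgType R) (Q : set A) (c : R) (a : A) :
  quadratic_module Q -> 0 < c -> infinitesimal Q a -> infinitesimal Q (c%:A * a).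
Proof.
move=> qmQ c0 ia e e0; have [pa na] := ia (e / c) (divr_gt0 e0 c0).
have -> : e%:A = c%:A * (e / c)%:A :> A.
  by rewrite -rmorphM /= mulrCA divff ?gt_eqF // mulr1.
by rewrite -mulrBr -mulrDr; split; apply: qm_scale => //; apply: ltW.
Qed.

(** The ideal property reduces by polarisation to multiplication by a square
    b^2, and b^2 a is within e b^2, hence within a multiple of e. *)
Lemma infinitesimalM (R : realType) (A : comAlgType R) (Q : set A) (a b : A) :
  quadratic_module Q -> archimedean Q -> infinitesimal Q a ->
  infinitesimal Q (b * a).
Proof.
move=> qmQ arQ; have [Q1 QD QM] := qmQ.
have sq x y : infinitesimal Q x -> infinitesimal Q (y ^+ 2 * x).
  move=> ix e e0; have [c c0 /(_ _ (lexx c))[Qc _]] := archimedeanP (y ^+ 2) qmQ arQ.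
  have ec0 : 0 < e / c by rewrite divr_gt0.
  have [px nx] := ix _ ec0.
  have eE : e%:A = (e / c)%:A * c%:A :> A.
    by rewrite -rmorphM /= divfK // gt_eqF.
  have -> : e%:A + y ^+ 2 * x =
    (e / c)%:A * (c%:A - y ^+ 2) + y ^+ 2 * ((e / c)%:A + x) by rewrite eE; ring.
  have -> : e%:A - y ^+ 2 * x =
    (e / c)%:A * (c%:A - y ^+ 2) + y ^+ 2 * ((e / c)%:A - x) by rewrite eE; ring.
  by split; (apply: QD; [apply: qm_scale => //; apply: ltW | apply: QM]).
move=> ia.
have -> : b * a = 4^-1%:A * ((b + 1) ^+ 2 * a + (b - 1) ^+ 2 * - a).
  by apply: eq_divr_alg; rewrite ?pnatr_eq0 //; ring.
apply: infinitesimalZ; rewrite // ?invr_gt0//; apply: infinitesimalD => //.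
  exact: sq.
by apply: sq; apply: infinitesimalN.
Qed.

Lemma proper_const_ge0 (R : realType) (A : comAlgType R) (Q : set A) (c : R) :
  quadratic_module Q -> ~ Q (-1) -> Q c%:A -> 0 <= c.
Proof.
move=> qmQ nQ Qc; rewrite leNgt; apply/negP => c0; apply: nQ.
have := qm_scale qmQ _ Qc (c := - c^-1).
rewrite -rmorphM /= mulNr mulVf ?lt_eqF // rmorphN1; apply.
by rewrite oppr_ge0 invr_le0 ltW.
Qed.

Lemma infinitesimal_const (R : realType) (A : comAlgType R) (Q : set A) (c : R) :
  quadratic_module Q -> ~ Q (-1) -> infinitesimal Q c%:A -> c = 0.
Proof.
move=> qmQ nQ ic; apply: contrapT => /eqP c0.
have nc0 : 0 < `|c| by rewrite normr_gt0.
have [pc pnc] := ic (`|c| / 2) (divr_gt0 nc0 (ltr0n _ 2)).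
have : 0 <= - (`|c| / 2).
  apply: (proper_const_ge0 qmQ nQ); have [cp|cn] := ltP 0 c.
    move: pnc; rewrite (gtr0_norm cp) -rmorphB /=; congr (Q _%:A).
    by field.
  move: pc; rewrite (ler0_norm cn) -rmorphD /=; congr (Q _%:A).
  by field.
by rewrite oppr_ge0 leNgt divr_gt0.
Qed.

Definition character (R : realType) (A : comAlgType R) (alpha : A -> R) : Prop :=
  [/\ forall c : R, alpha c%:A = c, {morph alpha : a b / a + b} &
      {morph alpha : a b / a * b}].

(** Since Q is total and archimedean, a is infinitely close to the supremum of
    the constants below it. *)
Lemma infinitesimally_const (R : realType) (A : comAlgType R) (Q : set A) (a : A) :
  maximal_proper Q -> archimedean Q -> exists c : R, infinitesimal Q (a - c%:A).
Proof.
move=> maxQ arQ; have [qmQ nQ _] := maxQ; have [Q1 QD QM] := qmQ.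
have [c c0 /(_ _ (lexx c))[cma cpa]] := archimedeanP a qmQ arQ.
pose S : set R := [set d | Q (a - d%:A)].
have S0 : S (- c) by rewrite /S /= rmorphN opprK addrC.
have Sub : ubound S c.
  move=> d Sd; rewrite -subr_ge0; apply: (proper_const_ge0 qmQ nQ).
  by have := QD _ _ cma Sd; congr Q; ring.
have hsS : has_sup S by split; [exists (- c) | exists c].
exists (sup S) => e e0; split.
  have [d Sd ltd] := sup_adherent e0 hsS.
  have -> : e%:A + (a - (sup S)%:A) = (d - (sup S - e))%:A + (a - d%:A) by ring.
  by apply: QD => //; apply: qm_const; rewrite // subr_ge0 ltW.
have [Qp|] := maximal_total (a - (sup S + e)%:A) maxQ.
  have := sup_upper_bound hsS Qp; rewrite gerDl leNgt e0 //.
by congr Q; ring.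
Qed.

(** Infinitesimals form an ideal in which 0 is the only constant, so the constant
    infinitely close to an element is unique and respects sums and products. *)
Lemma maximal_character (R : realType) (A : comAlgType R) (Q : set A) :
  maximal_proper Q -> archimedean Q ->
  exists2 alpha : A -> R, character alpha & forall a, Q a -> 0 <= alpha a.
Proof.
move=> maxQ arQ; have [qmQ nQ _] := maxQ; have [Q1 QD QM] := qmQ.
have [alpha alphaP] := choice (fun a => infinitesimally_const a maxQ arQ).
have uniq a (c : R) : infinitesimal Q (a - c%:A) -> alpha a = c.
  move=> ic; apply/eqP; rewrite -subr_eq0; apply/eqP.
  apply: (infinitesimal_const qmQ nQ).
  have := infinitesimalD qmQ ic (infinitesimalN (alphaP a)).
  by congr (infinitesimal Q _); ring.
exists alpha; first split.
- move=> c; apply: uniq; rewrite subrr => e e0.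
  by rewrite subr0 addr0; split; apply: qm_const => //; apply: ltW.
- move=> a b; apply: uniq.
  have := infinitesimalD qmQ (alphaP a) (alphaP b).
  by congr (infinitesimal Q _); ring.
- move=> a b; apply: uniq.
  have := infinitesimalD qmQ (infinitesimalM b qmQ arQ (alphaP a))
    (infinitesimalM (alpha a)%:A qmQ arQ (alphaP b)).
  by congr (infinitesimal Q _); ring.
move=> a Qa; rewrite leNgt; apply/negP => na.
have na2 : 0 < - alpha a / 2 by rewrite divr_gt0 // oppr_gt0.
have [_ Qe] := alphaP a _ na2.
have Qh : Q (alpha a / 2)%:A.
  have aE : alpha a = alpha a / 2 + alpha a / 2 by exact: splitr.
  have := QD _ _ Qe Qa; congr Q; rewrite {2}aE; ring.
have := proper_const_ge0 qmQ nQ Qh.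
by rewrite -oppr_le0 -mulNr leNgt na2.
Qed.

(** * The representation theorem for archimedean quadratic modules *)

(** The step that lowers the constant. The summands on the left of the identity
    (k - s)^2 (f + x) + 2 k (s f - 1) + x s (2 k - s) + (2 k - 1 - s^2 f)
      = k^2 f + k^2 x - 1
    all lie in Q; for the third one,
    2 k s (2 k - s) = s (2 k - s)^2 + s^2 (2 k - s). *)
Lemma lower_constant (R : realType) (A : comAlgType R) (Q : set A) (f : A)
    (u : seq A) (k x : R) (s := \sum_(v <- u) v ^+ 2) :
  quadratic_module Q -> Q (s * f - 1) -> 0 < k ->
  Q ((2 * k)%:A - s) -> Q ((2 * k - 1)%:A - s ^+ 2 * f) ->
  0 <= x -> Q (f + x%:A) -> Q (f + (x - k ^- 2)%:A).
Proof.
move=> qmQ Qsf k0 Qs Qsf2 x0 Qfx; have [Q1 QD QM] := qmQ.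
have k2 : 0 < 2 * k by rewrite mulr_gt0.
have Qthird : Q (s * ((2 * k)%:A - s)).
  have -> : s * ((2 * k)%:A - s) = ((2 * k)^-1)%:A *
      (s * (((2 * k)%:A - s) ^+ 2 * 1) + s ^+ 2 * ((2 * k)%:A - s)).
    by apply: eq_divr_alg; [rewrite gt_eqF | ring].
  apply: qm_scale => //; first by rewrite invr_ge0 ltW.
  by apply: QD; [apply: qm_sum_squares => //; apply: QM | apply: QM].
have -> : f + (x - k ^- 2)%:A = (k ^- 2)%:A * ((k%:A - s) ^+ 2 * (f + x%:A)
    + (2 * k)%:A * (s * f - 1) + x%:A * (s * ((2 * k)%:A - s))
    + ((2 * k - 1)%:A - s ^+ 2 * f)).
  have k20 : k ^+ 2 != 0 by rewrite expf_neq0 // gt_eqF.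
  apply: eq_divr_alg => //; rewrite mulrDr -rmorphM /= mulrBr divff //.
  by ring.
apply: qm_scale => //; first by rewrite invr_ge0 exprn_ge0 // ltW.
apply/QD => //; apply/QD; first apply/QD; first exact: QM.
  by apply: qm_scale => //; apply: ltW.
exact: qm_scale.
Qed.

(** A character that is nonnegative on Q is positive at f, hence negative at - f.
    By maximal_character, adjoining - f to Q therefore gives an improper module, so
    -1 = q - s f. Some f + x lies in Q by the archimedean property, and x can be
    lowered by the fixed amount 1 / k^2 until it is no longer positive. *)
Theorem archimedean_positive_mem (R : realType) (A : comAlgType R) (Q : set A) (f : A) :
  quadratic_module Q -> archimedean Q ->
  (forall alpha, character alpha -> (forall a, Q a -> 0 <= alpha a) -> 0 < alpha f) ->
  Q f.
Proof.
move=> qmQ arQ fpos; have [Q1 QD QM] := qmQ.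
have [q [u [Qq e]]] : adjoin Q (- f) (-1).
  apply: contrapT => nadj.
  have qmN := adjoin_quadratic_module (- f) qmQ.
  have [Q' maxQ' adjQ'] := exists_maximal_proper qmN nadj.
  have arQ' : archimedean Q'.
    by move=> a; have [c Qc] := arQ a; exists c; apply/adjQ'/sub_adjoin.
  have [alpha ch alphaQ'] := maximal_character maxQ' arQ'.
  have := fpos _ ch (fun a Qa => alphaQ' _ (adjQ' _ (sub_adjoin _ Qa))).
  have /alphaQ' := adjQ' _ (mem_adjoin (- f) qmQ).
  case: ch => aC aD aM; rewrite -mulN1r -(rmorphN1 (in_alg A)) aM aC mulN1r oppr_ge0.
  by move=> /le_lt_trans h /h; rewrite ltxx.
set s := \sum_(v <- u) v ^+ 2 in e.
have Qsf : Q (s * f - 1).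
  by rewrite e; move: Qq; congr Q; ring.
have [c1 c10 Qc1] := archimedeanP s qmQ arQ.
have [c2 c20 Qc2] := archimedeanP (s ^+ 2 * f) qmQ arQ.
have [x x0 /(_ _ (lexx x))[_ Qx]] := archimedeanP f qmQ arQ.
pose k := c1 + c2 + 1.
have k0 : 0 < k by rewrite !addr_gt0.
have Qs : Q ((2 * k)%:A - s) by apply: (Qc1 _ _).1; rewrite /k; lra.
have Qs2 : Q ((2 * k - 1)%:A - s ^+ 2 * f) by apply: (Qc2 _ _).1; rewrite /k; lra.
have steps (N : nat) : Q (f + (x - N%:R * k ^- 2)%:A) \/ Q f.
  elim: N => [|N [IH|]]; [|..|by right].
    by left; rewrite mul0r subr0 addrC.
  have [pos|neg] := leP 0 (x - N%:R * k ^- 2).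
    left; have := lower_constant qmQ Qsf k0 Qs Qs2 pos IH.
    by congr (Q (f + _%:A)); rewrite -[N.+1]addn1 natrD mulrDl mul1r opprD addrA.
  right; have -> : f = f + (x - N%:R * k ^- 2)%:A + (- (x - N%:R * k ^- 2))%:A by ring.
  by apply: QD => //; apply: qm_const; rewrite // oppr_ge0 ltW.
have [N xN] : exists N : nat, x <= N%:R * k ^- 2.
  exists (Num.truncn (x * k ^+ 2)).+1.
  rewrite -ler_pdivrMr ?invr_gt0 ?exprn_gt0 // invrK ltW //.
  by have /andP[] := truncn_itv (mulr_ge0 (ltW x0) (exprn_ge0 2 (ltW k0))).
have [QN|//] := steps N.
have -> : f = f + (x - N%:R * k ^- 2)%:A + (- (x - N%:R * k ^- 2))%:A by ring.
by apply: QD => //; apply: qm_const; rewrite // oppr_ge0 subr_le0.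
Qed.

(** * Polynomials as an archimedean algebra *)

Lemma peval_const (R : realType) (n : nat) (c : R) (v : 'rV[R]_n) :
  peval (mpolyC n c) v = c.
Proof. exact: mevalC. Qed.

Lemma peval_mvar (R : realType) (n : nat) (i : 'I_n) (v : 'rV[R]_n) :
  peval (mvar R i) v = v ord0 i.
Proof. exact: mevalXU. Qed.

Lemma peval_sum (R : realType) (n : nat) (I : Type) (u : seq I) (P : pred I)
    (F : I -> {mpoly R[n]}) (v : 'rV[R]_n) :
  peval (\sum_(i <- u | P i) F i) v = \sum_(i <- u | P i) peval (F i) v.
Proof. exact: raddf_sum. Qed.

Lemma peval_sos (R : realType) (n : nat) (p : {mpoly R[n]}) (v : 'rV[R]_n) :
  sos p -> 0 <= peval p v.
Proof.
by move=> [u ->]; rewrite peval_sum sumr_ge0 // => q _; rewrite /peval rmorphXn sqr_ge0.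
Qed.

Lemma peval_rename (R : realType) (n k : nat) (e : 'I_n -> 'I_k) (p : {mpoly R[n]})
    (v : 'rV[R]_k) : peval (rename e p) v = peval p (\row_i v ord0 (e i)).
Proof.
rewrite /peval /rename comp_mpoly_meval; apply: meval_eq => i.
by rewrite tnth_mktuple mevalXU mxE.
Qed.

Lemma mpoly_algebra_ind (R : realType) (n : nat) (P : {mpoly R[n]} -> Prop) :
  (forall c : R, P (mpolyC n c)) -> (forall i, P (mvar R i)) ->
  (forall p q, P p -> P q -> P (p + q)) -> (forall p q, P p -> P q -> P (p * q)) ->
  forall p, P p.
Proof.
move=> PC PX PD PM; apply: mpolyind => [|c u p _ _ Pp]; first by rewrite -mpolyC0.
apply: PD => //; rewrite -mul_mpolyC; apply: (PM) => //.
rewrite mpolyXE_id; elim/big_ind: _ => [||i _]; [by rewrite -mpolyC1 | exact: PM |].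
by elim: (u i) => [|k IH]; rewrite ?expr0 -?mpolyC1 // exprS; apply: PM => //; apply: PX.
Qed.

Lemma mpolyC_in_alg (R : realType) (n : nat) (c : R) :
  mpolyC n c = c%:A :> {mpoly R[n]}.
Proof. by rewrite GRing.in_algE alg_mpolyC. Qed.

Lemma character_mpoly (R : realType) (n : nat) (alpha : {mpoly R[n]} -> R) :
  character alpha -> forall p, alpha p = peval p (\row_i alpha (mvar R i)).
Proof.
move=> [aC aD aM]; apply: mpoly_algebra_ind => [c|i|p q ep eq|p q ep eq].
- by rewrite peval_const mpolyC_in_alg aC.
- by rewrite peval_mvar mxE.
- by rewrite aD ep eq /peval rmorphD.
- by rewrite aM ep eq /peval rmorphM.
Qed.

(** The square-bounded elements form a subalgebra, so it suffices to bound the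
    variables, and c - X_i^2 is c - |X|^2 plus squares. *)
Lemma archimedean_mpoly (R : realType) (n : nat) (Q : set {mpoly R[n]}) (c : R) :
  quadratic_module Q -> Q (mpolyC n c - sqnorm R n) -> archimedean Q.
Proof.
move=> qmQ Qc a; have [Q1 QD QM] := qmQ.
suff [d d0 Qd] : exists2 d : R, 0 <= d & Q (d%:A - a ^+ 2).
  by exists ((d + 1) / 2); apply: bounded_by_square.
move: a; apply: mpoly_algebra_ind => [d|i|p q|p q].
- exists (d ^+ 2); first exact: sqr_ge0.
  by rewrite mpolyC_in_alg rmorphXn subrr; apply: qm0.
- exists `|c| => //.
  have -> : `|c|%:A - mvar R i ^+ 2 =
      (`|c| - c)%:A + (mpolyC n c - sqnorm R n + \sum_(j < n | j != i) mvar R j ^+ 2).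
    rewrite /sqnorm (bigD1 i) //=.
    by rewrite mpolyC_in_alg; ring.
  apply: (QD); first by apply: qm_const; rewrite // subr_ge0 ler_norm.
  apply: (QD) => //; elim/big_ind: _ => [||j _]; [exact: qm0 | exact: QD |].
  by rewrite -[_ ^+ 2]mulr1; apply: QM.
- exact: square_boundedD.
- exact: square_boundedM.
Qed.

(** The minus signs reflect that the set described is g i <= 0, h j = 0. *)
Definition generated_qm (R : realType) (n : nat) (I J : finType)
    (g : I -> {mpoly R[n]}) (h : J -> {mpoly R[n]}) : set {mpoly R[n]} :=
  [set p | exists (sigma0 : {mpoly R[n]}) (sigma : I -> {mpoly R[n]})
      (phi : J -> {mpoly R[n]}),
    [/\ p = sigma0 - \sum_i sigma i * g i - \sum_j phi j * h j,
        sos sigma0 & forall i, sos (sigma i)]].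

Lemma sosD (R : realType) (n : nat) (p q : {mpoly R[n]}) : sos p -> sos q -> sos (p + q).
Proof. by move=> [u ->] [w ->]; exists (u ++ w); rewrite big_cat. Qed.

Lemma sosM2 (R : realType) (n : nat) (p q : {mpoly R[n]}) : sos q -> sos (p ^+ 2 * q).
Proof.
move=> [u ->]; exists [seq p * v | v <- u].
by rewrite big_map big_distrr; apply: eq_bigr => v _; rewrite /= exprMn.
Qed.

Lemma sos0 (R : realType) (n : nat) : sos (0 : {mpoly R[n]}).
Proof. by exists [::]; rewrite big_nil. Qed.

Lemma sos1 (R : realType) (n : nat) : sos (1 : {mpoly R[n]}).
Proof. by exists [:: 1]; rewrite big_seq1 expr1n. Qed.

Lemma generated_quadratic_module (R : realType) (n : nat) (I J : finType)
    (g : I -> {mpoly R[n]}) (h : J -> {mpoly R[n]}) :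
  quadratic_module (generated_qm g h).
Proof.
split.
- exists 1, (fun=> 0), (fun=> 0); split; [|exact: sos1|move=> _; exact: sos0].
  by rewrite !big1 ?subr0 // => i _; rewrite mul0r.
- move=> p q [s0 [s [t [-> s0s ss]]]] [s0' [s' [t' [-> s0s' ss']]]].
  exists (s0 + s0'), (fun i => s i + s' i), (fun j => t j + t' j).
  split; [|exact: sosD|by move=> i; apply: sosD].
  under [X in _ = _ - X - _]eq_bigr do rewrite mulrDl.
  under [X in _ = _ - X]eq_bigr do rewrite mulrDl.
  by rewrite !big_split /=; ring.
- move=> a p [s0 [s [t [-> s0s ss]]]].
  exists (a ^+ 2 * s0), (fun i => a ^+ 2 * s i), (fun j => a ^+ 2 * t j).
  split; [|exact: sosM2|by move=> i; apply: sosM2].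
  under [X in _ = _ - X - _]eq_bigr do rewrite -mulrA.
  under [X in _ = _ - X]eq_bigr do rewrite -mulrA.
  by rewrite -!big_distrr /=; ring.
Qed.

Lemma generated_qm_sos (R : realType) (n : nat) (I J : finType)
    (g : I -> {mpoly R[n]}) (h : J -> {mpoly R[n]}) (p : {mpoly R[n]}) :
  sos p -> generated_qm g h p.
Proof.
move=> sp; exists p, (fun=> 0), (fun=> 0); split => //; last by move=> _; apply: sos0.
by rewrite !big1 ?subr0 // => i _; rewrite mul0r.
Qed.

Lemma generated_qm_ineq (R : realType) (n : nat) (I J : finType)
    (g : I -> {mpoly R[n]}) (h : J -> {mpoly R[n]}) (p : {mpoly R[n]}) (i : I) :
  sos p -> generated_qm g h (- (p * g i)).
Proof.
move=> sp; exists 0, (fun k => if k == i then p else 0), (fun=> 0).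
split; [|exact: sos0|by move=> k; case: ifP => // _; exact: sos0].
rewrite (bigD1 i) //= eqxx big1 ?addr0; last by move=> k /negPf ->; rewrite mul0r.
by rewrite big1 ?subr0 ?sub0r // => k _; rewrite mul0r.
Qed.

Lemma generated_qm_eq (R : realType) (n : nat) (I J : finType)
    (g : I -> {mpoly R[n]}) (h : J -> {mpoly R[n]}) (p : {mpoly R[n]}) (j : J) :
  generated_qm g h (p * h j).
Proof.
exists 0, (fun=> 0), (fun k => if k == j then - p else 0).
split; [|exact: sos0|by move=> _; exact: sos0].
rewrite [X in _ - _ - X](bigD1 j) //= eqxx [X in _ - (_ + X)]big1; last first.
  by move=> k /negPf ->; rewrite mul0r.
by rewrite big1 ?subr0 ?sub0r ?addr0 ?mulNr ?opprK // => k _; rewrite mul0r.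
Qed.

(** Putinar's Positivstellensatz. The characters are the evaluations, and those
    nonnegative on the quadratic module are the points of the semialgebraic set,
    since h j and - h j both belong to the module. *)
Theorem putinar (R : realType) (n : nat) (I J : finType)
    (g : I -> {mpoly R[n]}) (h : J -> {mpoly R[n]}) (c : R) (p : {mpoly R[n]}) :
  generated_qm g h (mpolyC n c - sqnorm R n) ->
  (forall v, (forall i, peval (g i) v <= 0) -> (forall j, peval (h j) v = 0) ->
     0 < peval p v) ->
  generated_qm g h p.
Proof.
move=> Qc ppos; have qmQ := generated_quadratic_module g h.
apply: archimedean_positive_mem => //; first exact: archimedean_mpoly Qc.
move=> alpha ch alphaQ; rewrite character_mpoly //; apply: ppos => [i|j];
  rewrite -character_mpoly //; have [aC aD aM] := ch.
  have aN q : alpha (- q) = - alpha q.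
    by rewrite -mulN1r -(rmorphN1 (in_alg _)) aM aC mulN1r.
  have := alphaQ _ (generated_qm_ineq g h i (sos1 R n)).
  by rewrite mul1r aN oppr_ge0.
apply: le_anti.
have := alphaQ _ (generated_qm_eq g h 1 j); rewrite mul1r => ->.
have := alphaQ _ (generated_qm_eq g h (-1) j).
by rewrite -(rmorphN1 (in_alg _)) aM aC mulN1r oppr_ge0 => ->.
Qed.

(** * Polynomials along a line *)

Definition dot (R : realType) (m : nat) (u v : 'rV[R]_m) : R :=
  \sum_i u ord0 i * v ord0 i.

Lemma dotDr (R : realType) (m : nat) (u v w : 'rV[R]_m) :
  dot u (v + w) = dot u v + dot u w.
Proof. by rewrite /dot -big_split; apply: eq_bigr => i _; rewrite mxE mulrDr. Qed.

Lemma dotZr (R : realType) (m : nat) (c : R) (u v : 'rV[R]_m) :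
  dot u (c *: v) = c * dot u v.
Proof. by rewrite /dot big_distrr; apply: eq_bigr => i _; rewrite mxE mulrCA. Qed.

Lemma dotC (R : realType) (m : nat) (u v : 'rV[R]_m) : dot u v = dot v u.
Proof. by apply: eq_bigr => i _; rewrite mulrC. Qed.

Lemma dot_gt0 (R : realType) (m : nat) (u : 'rV[R]_m) : u != 0 -> 0 < dot u u.
Proof.
move=> u0; rewrite lt_neqAle sumr_ge0 ?andbT; last by move=> i _; rewrite -expr2 sqr_ge0.
apply: contraNneq u0 => /esym /eqP; rewrite psumr_eq0; last first.
  by move=> i _; rewrite -expr2 sqr_ge0.
move=> /allP ui; apply/eqP/rowP => i; rewrite mxE.
by have := ui i (mem_index_enum _); rewrite mulf_eq0 orbb => /eqP.
Qed.

Lemma dot_sumZl (R : realType) (m : nat) (I : finType) (l : I -> R) (v : I -> 'rV[R]_m)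
    (d : 'rV[R]_m) : dot (\sum_i l i *: v i) d = \sum_i l i * dot (v i) d.
Proof.
rewrite dotC; transitivity (\sum_i dot d (l i *: v i)); last first.
  by apply: eq_bigr => i _; rewrite dotZr dotC.
rewrite /dot exchange_big /=; apply: eq_bigr => j _.
by rewrite summxE big_distrr.
Qed.

(** Taylor expansion of order two. That the remainder is polynomial in t makes it
    stable under products, and bounded for t in [0, 1]. *)
Lemma peval_line (R : realType) (m : nat) (p : {mpoly R[m]}) (y d : 'rV[R]_m) :
  exists psi : {poly R}, forall t : R,
    peval p (y + t *: d) = peval p y + t * dot (gradient p y) d + t ^+ 2 * psi.[t].
Proof.
move: p; apply: mpoly_algebra_ind => [c|i|p q [a pa] [b qb]|p q [a pa] [b qb]].
- exists 0 => t; rewrite !peval_const horner0 /dot big1 ?mulr0 ?addr0 // => i _.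
  by rewrite mxE mderivC /peval meval0 mul0r.
- exists 0 => t; rewrite !peval_mvar horner0 !mxE mulr0 addr0; congr (_ + _ * _).
  rewrite /dot (bigD1 i) //= big1 ?addr0 => [|j ji]; rewrite mxE /mvar mderivX mnm1E.
    have -> : mnm_sub (mnm1 i) (mnm1 i) = mnm0.
      by apply/mnmP => k; rewrite mnmBE mnm0E subnn.
    by rewrite eqxx scale1r mpolyX0 /peval meval1 mul1r.
  by rewrite eq_sym (negPf ji) scale0r /peval meval0 mul0r.
- exists (a + b) => t; rewrite /peval !mevalD -!/(peval _ _) pa qb hornerD.
  have -> : dot (gradient (p + q) y) d = dot (gradient p y) d + dot (gradient q y) d.
    rewrite ![dot _ d]dotC -dotDr; congr dot; apply/rowP => i.
    by rewrite !mxE mderivD /peval mevalD.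
  by ring.
pose A := dot (gradient p y) d; pose B := dot (gradient q y) d.
exists ((A * B)%:P + peval p y *: b + peval q y *: a
        + 'X * (A *: b + B *: a) + 'X ^+ 2 * a * b) => t.
rewrite /peval !mevalM -!/(peval _ _) pa qb !hornerE -/A -/B.
have -> : dot (gradient (p * q) y) d = peval q y * A + peval p y * B.
  rewrite /A /B ![dot _ d]dotC -!dotZr -dotDr; congr dot; apply/rowP => i.
  by rewrite !mxE mderivM /peval mevalD !mevalM; ring.
by ring.
Qed.

Lemma peval_line_bound (R : realType) (m : nat) (p : {mpoly R[m]}) (y d : 'rV[R]_m) :
  exists2 C : R, 0 < C & forall t : R, 0 <= t <= 1 ->
    `|peval p (y + t *: d) - (peval p y + t * dot (gradient p y) d)| <= t ^+ 2 * C.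
Proof.
have [psi psiP] := peval_line p y d; have [C CP] := poly_itv_bound psi 0 1.
exists (`|C| + 1) => [|t t01]; first by rewrite ltr_wpDl.
rewrite psiP addrAC subrr add0r normrM normrX ger0_norm; last by case/andP: t01.
apply: ler_wpM2l; first exact: sqr_ge0.
by apply: le_trans (CP t t01) _; apply: le_trans (ler_norm _) _; rewrite lerDl.
Qed.

Lemma affine_neg (R : realType) (x z : R) :
  x < 0 -> exists2 e : R, 0 < e & forall t, 0 < t <= e -> x + t * z < 0.
Proof.
move=> x0; have z0 : 0 < `|z| + 1 by rewrite ltr_wpDl.
exists (- x / (`|z| + 1)) => [|t /andP[t0]]; first by rewrite divr_gt0 ?oppr_gt0.
rewrite ler_pdivlMr // => tx; rewrite -ltrBrDl sub0r; apply: lt_le_trans tx.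
by rewrite ltr_pM2l // (le_lt_trans (ler_norm _)) // ltrDl.
Qed.

Lemma exists_small_forall (R : realType) (I : finType) (P : I -> R -> Prop) :
  (forall i, exists2 e : R, 0 < e & forall t, 0 < t <= e -> P i t) ->
  exists2 e : R, 0 < e & forall t, 0 < t <= e -> forall i, P i t.
Proof.
move=> small.
have /choice[e eP] : forall i, exists e : R, 0 < e /\ forall t, 0 < t <= e -> P i t.
  by move=> i; have [e e0 eP] := small i; exists e.
exists (\big[Order.min/1]_i e i) => [|t /andP[t0 te] i].
  elim/big_ind: _ => [|x y x0 y0|i _]; first exact: ltr01.
    by rewrite lt_min x0.
  by case: (eP i).
by apply: (eP i).2; rewrite t0 (le_trans te) // bigmin_le.
Qed.

(** A negative value at y persists for small t, and a zero value becomes negative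
    through the first-order term. *)
Lemma peval_line_neg (R : realType) (m : nat) (p : {mpoly R[m]}) (y d : 'rV[R]_m) :
  peval p y < 0 \/ (peval p y = 0 /\ dot (gradient p y) d < 0) ->
  exists2 e : R, 0 < e & forall t, 0 < t <= e -> peval p (y + t *: d) < 0.
Proof.
have [C C0 CP] := peval_line_bound p y d; set D := dot _ d in CP *.
have bound (t : R) : 0 < t <= 1 -> peval p (y + t *: d) <= peval p y + t * (D + t * C).
  move=> /andP[t0 t1]; have /CP : 0 <= t <= 1 by rewrite ltW.
  move=> /(le_trans (ler_norm _)); rewrite lerBlDr => /le_trans; apply.
  by rewrite le_eqVlt; apply/orP; left; apply/eqP; ring.
move=> [py|[py D0]].
  have [e e0 eP] := affine_neg (`|D| + C) py.
  exists (Order.min e 1) => [|t /andP[t0]]; first by rewrite lt_min e0 ltr01.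
  rewrite le_min => /andP[te t1]; apply: le_lt_trans (bound t _) _; first by rewrite t0.
  apply: le_lt_trans (eP t _); last by rewrite t0.
  rewrite lerD2l ler_pM2l // lerD ?ler_norm //.
  by rewrite ger_pMl.
have [e e0 eP] := affine_neg C D0.
exists (Order.min e 1) => [|t /andP[t0]]; first by rewrite lt_min e0 ltr01.
rewrite le_min => /andP[te t1]; apply: le_lt_trans (bound t _) _; first by rewrite t0.
by rewrite py add0r pmulr_rlt0 // eP // t0.
Qed.

(** * Fritz John and Karush-Kuhn-Tucker conditions *)

(** Gordan's alternative. A direction d that works for the tail of the list
    either works for its head v0, or satisfies a = v0 . d >= 0. If a = 0, a small
    multiple of - v0 is added to d. If a > 0, the vectors a (v i) - (v i . d) v0,
    which are nonnegative combinations of v i and v0, are orthogonal to d; a relation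
    between them is one between the original vectors, and a direction e for them is
    moved along d until v0 . e is just below 0. *)
Lemma gordan (R : realType) (m : nat) (I : finType) (v : I -> 'rV[R]_m) (s : seq I) :
  (exists d, forall i, i \in s -> dot (v i) d < 0) \/
  (exists l : I -> R, [/\ forall i, 0 <= l i, forall i, i \notin s -> l i = 0,
     exists i, 0 < l i & \sum_i l i *: v i = 0]).
Proof.
elim: s v => [|i0 s IH] v; first by left; exists 0.
(* If v i0 = 0, the head alone gives a relation. *)
have [v0|v0] := eqVneq (v i0) 0.
  right; exists (fun i => (i == i0)%:R); split=> [i|i||]; first exact: ler0n.
  - by rewrite inE negb_or => /andP[/negPf ->].
  - by exists i0; rewrite eqxx.
  by rewrite big1 // => i _; case: eqP => [->|]; rewrite ?v0 ?scaler0 ?scale0r.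
case: (IH v) => [[d dP]|[l [l0 ls lpos lv]]]; last first.
  right; exists l; split => // i; rewrite inE negb_or => /andP[_]; exact: ls.
have [a0|a0] := ltP (dot (v i0) d) 0.
  by left; exists d => i; rewrite inE => /orP[/eqP ->|/dP].
set a := dot (v i0) d in a0; pose b i := - dot (v i) d.
have small (x z : I -> R) : (forall i, i \in s -> x i < 0) ->
    exists2 e : R, 0 < e & forall i, i \in s -> x i + e * z i < 0.
  move=> xs; have [|e e0 eP] := @exists_small_forall R I
      (fun i t => i \in s -> x i + t * z i < 0).
    move=> i; case: (boolP (i \in s)) => [/xs xi|_]; last by exists 1.
    by have [e e0 eP] := affine_neg (z i) xi; exists e => // t te _; apply: eP.
  by exists e => // i; apply: eP; rewrite e0 /=.
have [az|anz] := eqVneq a 0.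
  have [e e0 eP] := small _ (fun i => dot (v i) (- v i0)) dP.
  left; exists (d + e *: - v i0) => i; rewrite dotDr dotZr inE => /orP[/eqP ->|/eP //].
  rewrite -/a az add0r -scaleN1r dotZr mulN1r mulrN oppr_lt0 mulr_gt0 //.
  exact: dot_gt0.
have {a0 anz} a0 : 0 < a by rewrite lt_neqAle eq_sym anz.
case: (IH (fun i => a *: v i + b i *: v i0)) => [[e eP]|[l [l0 ls [k lk] lv]]].
  pose t0 := - dot (v i0) e / a.
  have [i si|del del0 delP] :=
    small (fun i => dot (v i) e + t0 * dot (v i) d) (fun i => - dot (v i) d).
    have := eP i si; rewrite dotC dotDr !dotZr ![dot e _]dotC /b => lt0.
    rewrite -(pmulr_rlt0 _ a0); apply: le_lt_trans lt0.
    by rewrite le_eqVlt /t0; apply/orP; left; apply/eqP; field; rewrite gt_eqF.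
  left; exists (e + (t0 - del) *: d) => i; rewrite dotDr dotZr inE => /orP[/eqP ->|/delP].
    rewrite -/a; have -> : dot (v i0) e + (t0 - del) * a = - (del * a).
      by rewrite /t0; field; rewrite gt_eqF.
    by rewrite oppr_lt0 mulr_gt0.
  by rewrite mulrBl mulrN addrA.
have lb i : 0 <= l i * b i.
  have [si|/ls ->] := boolP (i \in s); last by rewrite mul0r.
  by rewrite mulr_ge0 // oppr_ge0 ltW // dP.
have sk : k \in s by apply: contraLR lk => /ls ->; rewrite ltxx.
right; exists (fun i => a * l i + (i == i0)%:R * \sum_j l j * b j); split => [i|i||].
- by rewrite addr_ge0 // mulr_ge0 ?ler0n ?(ltW a0) // sumr_ge0.
- rewrite inE negb_or => /andP[/negPf -> /ls ->].
  by rewrite mulr0 mul0r addr0.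
- exists i0; rewrite eqxx mul1r; apply: ltr_wpDl; first by rewrite mulr_ge0 // ltW.
  rewrite (bigD1 k) //= ltr_pwDl ?sumr_ge0 // mulr_gt0 // oppr_gt0; exact: dP.
rewrite -[RHS]lv.
under eq_bigr do rewrite scalerDl.
under [RHS]eq_bigr do rewrite scalerDr !scalerA.
rewrite !big_split /=; congr (_ + _).
  by apply: eq_bigr => i _; rewrite mulrC.
rewrite (bigD1 i0) //= eqxx mul1r [X in _ + X]big1 ?addr0 => [|i /negPf ->].
  by rewrite scaler_suml.
by rewrite mul0r scale0r.
Qed.

Definition lower_gradient (R : realType) (n m : nat) (G : {mpoly R[n + m]})
    (x : 'rV[R]_n) (y : 'rV[R]_m) : 'rV[R]_m :=
  \row_i peval (mderiv (rshift n i) G) (row_mx x y).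

Lemma dot_lower_gradient (R : realType) (n m : nat) (G : {mpoly R[n + m]})
    (x : 'rV[R]_n) (y d : 'rV[R]_m) :
  dot (gradient G (row_mx x y)) (row_mx 0 d) = dot (lower_gradient G x y) d.
Proof.
rewrite /dot big_split_ord /= big1 ?add0r => [|i _].
  apply: eq_bigr => i _.
  by rewrite row_mxEr [gradient _ _ _ _]mxE [lower_gradient _ _ _ _ _]mxE.
by rewrite row_mxEl [X in _ * X]mxE mulr0.
Qed.

Lemma row_mx_line (R : realType) (n m : nat) (x : 'rV[R]_n) (y d : 'rV[R]_m) (t : R) :
  row_mx x y + t *: row_mx 0 d = row_mx x (y + t *: d).
Proof. by rewrite scale_row_mx scaler0 add_row_mx addr0. Qed.

(** Here l ord0 is the multiplier of the objective, and the multipliers are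
    normalized on the unit sphere. *)
Definition fritz_john (R : realType) (n m r : nat) (G : {mpoly R[n + m]})
    (h : 'I_r -> {mpoly R[m]}) (x : 'rV[R]_n) (y : 'rV[R]_m) (l : 'I_r.+1 -> R) : Prop :=
  [/\ forall j, 0 <= l j, forall j, l (lift ord0 j) * peval (h j) y = 0,
      l ord0 *: lower_gradient G x y
        + \sum_j l (lift ord0 j) *: gradient (h j) y = 0 &
      \sum_j l j ^+ 2 = 1].

(** By Gordan's alternative, if there are no multipliers, some direction decreases
    the objective and all active constraints strictly, while the inactive ones stay
    satisfied nearby, so that y is not a minimizer. *)
Lemma fritz_john_necessary (R : realType) (n m r : nat) (G : {mpoly R[n + m]})
    (h : 'I_r -> {mpoly R[m]}) (x : 'rV[R]_n) (y : 'rV[R]_m) :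
  lower_solutions G h x y -> exists l, fritz_john G h x y l.
Proof.
move=> [yF ymin].
pose v (i : 'I_r.+1) :=
  if unlift ord0 i is Some j then gradient (h j) y else lower_gradient G x y.
pose act (i : 'I_r.+1) :=
  if unlift ord0 i is Some j then peval (h j) y == 0 else true.
have vl j : v (lift ord0 j) = gradient (h j) y by rewrite /v liftK.
have v0 : v ord0 = lower_gradient G x y by rewrite /v unlift_none.
case: (gordan v [seq i <- enum 'I_r.+1 | act i]) => [[d dP]|[l [l0 ls [k lk] lv]]].
  have {}dP i : act i -> dot (v i) d < 0.
    by move=> ai; apply: dP; rewrite mem_filter ai mem_enum.
  exfalso.
  have [|e e0 eP] := @exists_small_forall R 'I_r
      (fun j t => peval (h j) (y + t *: d) < 0).
    move=> j; apply: peval_line_neg; have := yF j; rewrite le_eqVlt.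
    move=> /orP[/eqP hj|]; [right; split => // | by left].
    by rewrite -vl; apply: dP; rewrite /act liftK hj.
  have [|e' e'0 e'P] := @peval_line_neg R _ (G - mpolyC _ (peval G (row_mx x y)))
      (row_mx x y) (row_mx 0 d).
    right; split; first by rewrite /peval mevalB mevalC subrr.
    have -> : gradient (G - mpolyC _ (peval G (row_mx x y))) (row_mx x y)
        = gradient G (row_mx x y).
      by apply/rowP => i; rewrite !mxE mderivB mderivC subr0.
    by rewrite dot_lower_gradient -v0; apply: dP; rewrite /act unlift_none.
  pose t := Order.min e e'.
  have t0 : 0 < t by rewrite lt_min e0.
  have := e'P t; rewrite t0 ge_min lexx orbT /peval mevalB mevalC => /(_ isT).
  rewrite subr_lt0 -!/(peval _ _) row_mx_line ltNge ymin // => j.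
  by apply/ltW/eP; rewrite t0 ge_min lexx.
have N0 : 0 < \sum_j l j ^+ 2.
  rewrite (bigD1 k) //= ltr_pwDl ?exprn_gt0 // sumr_ge0 // => j _; exact: sqr_ge0.
pose c := (Num.sqrt (\sum_j l j ^+ 2))^-1.
exists (fun j => c * l j); split.
- by move=> j; rewrite mulr_ge0 // invr_ge0 sqrtr_ge0.
- move=> j; have [hj|hj] := eqVneq (peval (h j) y) 0; first by rewrite hj mulr0.
  by rewrite ls ?mulr0 ?mul0r // mem_filter /act liftK (negPf hj).
- rewrite big_ord_recl v0 in lv; rewrite -scalerA; under eq_bigr do rewrite -scalerA -vl.
  by rewrite -scaler_sumr -scalerDr lv scaler0.
under eq_bigr do rewrite exprMn.
rewrite -big_distrr /= exprVn sqr_sqrtr; last exact: ltW.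
by rewrite mulVf // gt_eqF.
Qed.

Lemma conv_segment (R : realType) (m : nat) (y w : 'rV[R]_m) (t : R)
    (t0 : 0 <= t) (t1 : t <= 1) :
  conv (Itv01 t0 t1) (w : convex_lmodType 'rV[R]_m) y = y + t *: (w - y).
Proof.
rewrite [LHS](_ : _ = t *: w + (1 - t) *: y) //.
by rewrite scalerBl scale1r scalerBr addrCA.
Qed.

Lemma lower_feasible_segment (R : realType) (m r : nat) (h : 'I_r -> {mpoly R[m]})
    (y w : 'rV[R]_m) (t : R) : convex_set (lower_feasible h) ->
  lower_feasible h y -> lower_feasible h w -> 0 <= t <= 1 ->
  lower_feasible h (y + t *: (w - y)).
Proof.
move=> cvx yF wF /andP[t0 t1].
have := cvx w y (Itv01 t0 t1); rewrite !inE => /(_ wF yF).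
by rewrite conv_segment.
Qed.

(** Otherwise h j would be positive at the beginning of the segment from y to w,
    which lies in the feasible set. *)
Lemma active_gradient_le0 (R : realType) (m r : nat) (h : 'I_r -> {mpoly R[m]})
    (y w : 'rV[R]_m) (j : 'I_r) : convex_set (lower_feasible h) ->
  lower_feasible h y -> lower_feasible h w -> peval (h j) y = 0 ->
  dot (gradient (h j) y) (w - y) <= 0.
Proof.
move=> cvx yF wF hj; rewrite leNgt; apply/negP => pos.
have [|e e0 eP] := @peval_line_neg R _ (- h j) y (w - y).
  right; split; first by rewrite /peval mevalN -/(peval _ _) hj oppr0.
  have -> : gradient (- h j) y = -1 *: gradient (h j) y.
    by apply/rowP => i; rewrite !mxE mderivN /peval mevalN mulN1r.
  by rewrite dotC dotZr dotC mulN1r oppr_lt0.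
pose t := Order.min e 1; have t0 : 0 < t by rewrite lt_min e0 ltr01.
have := eP t; rewrite t0 ge_min lexx => /(_ isT).
rewrite /peval mevalN oppr_lt0 ltNge -/(peval _ _) => /negP; apply.
by apply: lower_feasible_segment; rewrite // ge_min lexx orbT ltW.
Qed.

(** A small step from the Slater point along the nonzero gradient remains feasible,
    and applying active_gradient_le0 to its end makes the inequality at the Slater
    point strict. *)
Lemma active_gradient_lt0 (R : realType) (m r : nat) (h : 'I_r -> {mpoly R[m]})
    (y y0 : 'rV[R]_m) (j : 'I_r) : convex_set (lower_feasible h) ->
  nondegeneracy_condition h -> (forall i, peval (h i) y0 < 0) ->
  lower_feasible h y -> peval (h j) y = 0 ->
  dot (gradient (h j) y) (y0 - y) < 0.
Proof.
move=> cvx nondeg y0P yF hj; pose u := gradient (h j) y.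
have u0 : u != 0 by apply/eqP; exact: nondeg.
have [i|e e0 eP] := @exists_small_forall R 'I_r
    (fun i t => peval (h i) (y0 + t *: u) < 0).
  by apply: peval_line_neg; left.
have y0F : lower_feasible h (y0 + e *: u).
  by move=> i; apply/ltW/eP; rewrite e0 lexx.
have := active_gradient_le0 cvx yF y0F hj.
rewrite (addrAC y0) (dotDr _ (y0 - y)) dotZr -/u; apply: lt_le_trans.
by rewrite ltrDl mulr_gt0 // dot_gt0.
Qed.

(** By convexity the difference quotient at t in direction w - y is at most
    G(x, w) - G(x, y), and it differs from the directional derivative by at most
    t C. *)
Lemma convex_gradient_min (R : realType) (n m : nat) (G : {mpoly R[n + m]})
    (x : 'rV[R]_n) (y w : 'rV[R]_m) :
  convex_function [set: 'rV[R]_m] (fun w => peval G (row_mx x w)) ->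
  0 <= dot (lower_gradient G x y) (w - y) ->
  peval G (row_mx x y) <= peval G (row_mx x w).
Proof.
move=> cvx D0; rewrite leNgt; apply/negP => Gwy.
have [C C0 CP] := peval_line_bound G (row_mx x y) (row_mx 0 (w - y)).
set a := peval G (row_mx x y) in Gwy CP; set b := peval G (row_mx x w) in Gwy.
rewrite dot_lower_gradient in CP; set D := dot _ _ in D0 CP.
have ab0 : 0 < a - b by rewrite subr_gt0.
(* Chosen so that t C is at most half of a - b. *)
pose t := Order.min ((a - b) / (2 * C)) 1.
have t0 : 0 < t by rewrite lt_min ltr01 divr_gt0 // mulr_gt0.
have t1 : t <= 1 by rewrite ge_min lexx orbT.
have tC : t * C < a - b.
  have : t <= (a - b) / (2 * C) by rewrite ge_min lexx.
  rewrite -(ler_pM2r C0) => /le_lt_trans; apply.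
  have -> : (a - b) / (2 * C) * C = (a - b) / 2 by field; rewrite gt_eqF.
  by rewrite gtr_pMr // invf_lt1 // ltr1n.
have := CP t; rewrite (ltW t0) t1 row_mx_line => /(_ isT).
rewrite distrC => /(le_trans (ler_norm _)).
have : peval G (row_mx x (y + t *: (w - y))) <= t * b + (1 - t) * a.
  have := cvx (Itv01 (ltW t0) t1) w y; rewrite !inE => /(_ I I).
  by rewrite convRE conv_segment.
set c := peval _ _ => cab cD.
have : t * (a - b) <= t * (t * C).
  have tD : 0 <= t * D by rewrite mulr_ge0 // ltW.
  by lra.
by rewrite ler_pM2l // leNgt tC.
Qed.

(** The case l ord0 = 0 is excluded by pairing the stationarity relation with the
    direction y0 - y towards the Slater point, for which every active gradient
    contributes a negative number. With l ord0 > 0, pairing with w - y for a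
    feasible w shows that the objective does not decrease towards w. *)
Lemma fritz_john_sufficient (R : realType) (n m r : nat) (G : {mpoly R[n + m]})
    (h : 'I_r -> {mpoly R[m]}) (x : 'rV[R]_n) (y : 'rV[R]_m) (l : 'I_r.+1 -> R) :
  lower_convex G h -> nondegeneracy_condition h -> slater_condition h ->
  lower_feasible h y -> fritz_john G h x y l -> lower_solutions G h x y.
Proof.
move=> [cvxG cvxF] nondeg [y0 y0P] yF [l0 compl stat norm].
have pair d : l ord0 * dot (lower_gradient G x y) d
    + \sum_j l (lift ord0 j) * dot (gradient (h j) y) d = 0.
  rewrite -(dot_sumZl (fun j => l (lift ord0 j))) ![dot _ d]dotC -dotZr -dotDr stat.
  by rewrite /dot big1 // => i _; rewrite mxE mulr0.
have term w j : lower_feasible h w ->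
    l (lift ord0 j) * dot (gradient (h j) y) (w - y) <= 0.
  move=> wF; have /eqP := compl j; rewrite mulf_eq0 => /orP[/eqP ->|/eqP hj].
    by rewrite mul0r.
  by rewrite mulr_ge0_le0 // active_gradient_le0.
have y0F : lower_feasible h y0 by move=> j; apply/ltW.
have lpos : 0 < l ord0.
  rewrite lt_neqAle l0 andbT eq_sym; apply/eqP => l00.
  have := pair (y0 - y); rewrite l00 mul0r add0r => /eqP.
  rewrite -oppr_eq0 -sumrN psumr_eq0 => [/allP lz|j _]; last by rewrite oppr_ge0 term.
  have lj j : l (lift ord0 j) = 0.
    have := lz j (mem_index_enum _); rewrite /= oppr_eq0 mulf_eq0.
    move=> /orP[/eqP //|/eqP dz].
    have /eqP := compl j; rewrite mulf_eq0 => /orP[/eqP //|/eqP hj].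
    by have := active_gradient_lt0 cvxF nondeg y0P yF hj; rewrite dz ltxx.
  have /eqP := norm; rewrite big_ord_recl l00 expr0n add0r big1 => [|j _].
    by rewrite eq_sym oner_eq0.
  by rewrite lj expr0n.
split => // w wF; apply: convex_gradient_min; first exact: cvxG.
set S := \sum_j l (lift ord0 j) * dot (gradient (h j) y) (w - y).
rewrite -(pmulr_rge0 _ lpos) -(addrK S (l ord0 * _)) pair sub0r oppr_ge0.
by apply: sumr_le0 => j _; apply: term.
Qed.

(** * The polynomial system of the relaxation *)

Lemma peval_of_xy (R : realType) (n m r : nat) (p : {mpoly R[n + m]})
    (z : 'rV[R]_(n + m)) (l : 'rV[R]_r.+1) : peval (of_xy r p) (row_mx z l) = peval p z.
Proof.
by rewrite peval_rename; congr peval; apply/rowP => i; rewrite mxE row_mxEl.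
Qed.

Lemma peval_of_y (R : realType) (n m r : nat) (p : {mpoly R[m]})
    (x : 'rV[R]_n) (y : 'rV[R]_m) (l : 'rV[R]_r.+1) :
  peval (of_y n r p) (row_mx (row_mx x y) l) = peval p y.
Proof.
by rewrite peval_rename; congr peval; apply/rowP => i; rewrite mxE row_mxEl row_mxEr.
Qed.

Lemma peval_lambda (R : realType) (n m r : nat) (z : 'rV[R]_(n + m)) (l : 'rV[R]_r.+1)
    (j : 'I_r.+1) : peval (lambda R n m j) (row_mx z l) = l ord0 j.
Proof. by rewrite peval_mvar row_mxEr. Qed.

Lemma Ghat_upper (R : realType) (n m s r : nat) (g : 'I_s -> {mpoly R[n + m]})
    (h : 'I_r -> {mpoly R[m]}) (i : 'I_s) :
  Ghat g h (lshift r.+1 (lshift r i)) = of_xy r (g i).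
Proof. by rewrite /Ghat (unsplitK (inl _)) (unsplitK (inl _)). Qed.

Lemma Ghat_lower (R : realType) (n m s r : nat) (g : 'I_s -> {mpoly R[n + m]})
    (h : 'I_r -> {mpoly R[m]}) (j : 'I_r) :
  Ghat g h (lshift r.+1 (rshift s j)) = of_y n r (h j).
Proof. by rewrite /Ghat (unsplitK (inl _)) (unsplitK (inr _)). Qed.

Lemma Ghat_multiplier (R : realType) (n m s r : nat) (g : 'I_s -> {mpoly R[n + m]})
    (h : 'I_r -> {mpoly R[m]}) (j : 'I_r.+1) :
  Ghat g h (rshift (s + r) j) = - lambda R n m j.
Proof. by rewrite /Ghat (unsplitK (inr _)). Qed.

Lemma Hhat_complementarity (R : realType) (n m r : nat) (G : {mpoly R[n + m]})
    (h : 'I_r -> {mpoly R[m]}) (j : 'I_r) :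
  Hhat G h (lshift 1 (lshift m j)) = lambda R n m (lift ord0 j) * of_y n r (h j).
Proof. by rewrite /Hhat (unsplitK (inl _)) (unsplitK (inl _)). Qed.

Lemma Hhat_stationarity (R : realType) (n m r : nat) (G : {mpoly R[n + m]})
    (h : 'I_r -> {mpoly R[m]}) (i : 'I_m) :
  Hhat G h (lshift 1 (rshift r i)) =
    lambda R n m ord0 * of_xy r (mderiv (rshift n i) G) +
    \sum_(j < r) lambda R n m (lift ord0 j) * of_y n r (mderiv i (h j)).
Proof. by rewrite /Hhat (unsplitK (inl _)) (unsplitK (inr _)). Qed.

Lemma Hhat_sphere (R : realType) (n m r : nat) (G : {mpoly R[n + m]})
    (h : 'I_r -> {mpoly R[m]}) :
  Hhat G h (rshift (r + m) ord0) = \sum_(j < r.+1) lambda R n m j ^+ 2 - 1.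
Proof. by rewrite /Hhat (unsplitK (inr _)). Qed.

Lemma ord_split_ind (a b : nat) (P : 'I_(a + b) -> Prop) :
  (forall i, P (lshift b i)) -> (forall j, P (rshift a j)) -> forall k, P k.
Proof. by move=> Pl Pr k; rewrite -(splitK k); case: (fintype.split k). Qed.

Lemma hat_system (R : realType) (n m s r : nat) (g : 'I_s -> {mpoly R[n + m]})
    (G : {mpoly R[n + m]}) (h : 'I_r -> {mpoly R[m]}) (x : 'rV[R]_n) (y : 'rV[R]_m)
    (l : 'rV[R]_r.+1) (z := row_mx (row_mx x y) l) :
  ((forall p, peval (Ghat g h p) z <= 0) /\ (forall q, peval (Hhat G h q) z = 0)) <->
  [/\ forall i, peval (g i) (row_mx x y) <= 0, lower_feasible h y &
      fritz_john G h x y (l ord0)].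
Proof.
have statE i : peval (Hhat G h (lshift 1 (rshift r i))) z =
    (l ord0 ord0 *: lower_gradient G x y
     + \sum_j l ord0 (lift ord0 j) *: gradient (h j) y) ord0 i.
  rewrite Hhat_stationarity /peval mevalD mevalM -!/(peval _ _) peval_lambda peval_of_xy.
  rewrite !mxE summxE; congr (_ + _); rewrite peval_sum; apply: eq_bigr => j _.
  by rewrite /peval mevalM -!/(peval _ _) peval_lambda peval_of_y !mxE.
have sphE : peval (Hhat G h (rshift (r + m) ord0)) z = \sum_j l ord0 j ^+ 2 - 1.
  rewrite Hhat_sphere /peval mevalB meval1 -!/(peval _ _) peval_sum; congr (_ - _).
  by apply: eq_bigr => j _; rewrite /peval rmorphXn /= -/(peval _ _) peval_lambda.
have cmpE j : peval (Hhat G h (lshift 1 (lshift m j))) z =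
    l ord0 (lift ord0 j) * peval (h j) y.
  by rewrite Hhat_complementarity /peval mevalM -!/(peval _ _) peval_lambda peval_of_y.
split=> [[Gz Hz]|[gz hz [l0 compl stat norm]]].
  split=> [i|j|].
  - by have := Gz (lshift r.+1 (lshift r i)); rewrite Ghat_upper peval_of_xy.
  - by have := Gz (lshift r.+1 (rshift s j)); rewrite Ghat_lower peval_of_y.
  split=> [j|j||].
  - have := Gz (rshift (s + r) j).
    by rewrite Ghat_multiplier /peval mevalN -/(peval _ _) peval_lambda oppr_le0.
  - by rewrite -cmpE.
  - by apply/rowP => i; rewrite -statE Hz mxE.
  - by apply/eqP; rewrite -subr_eq0 -sphE Hz.
split.
  apply: ord_split_ind => [|j].
    apply: ord_split_ind => [i|j]; first by rewrite Ghat_upper peval_of_xy.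
    by rewrite Ghat_lower peval_of_y.
  by rewrite Ghat_multiplier /peval mevalN -/(peval _ _) peval_lambda oppr_le0.
apply: ord_split_ind => [|j].
  apply: ord_split_ind => [j|i]; first by rewrite cmpE.
  by rewrite statE stat mxE.
by rewrite [j]ord1 sphE norm subrr.
Qed.

(** * The relaxations *)

Lemma Q_feasible_mono (R : realType) (n m s r : nat) (f : {mpoly R[n + m]})
    (g : 'I_s -> {mpoly R[n + m]}) (G : {mpoly R[n + m]})
    (h : 'I_r -> {mpoly R[m]}) (k k' : nat) :
  (k <= k')%N -> Q_feasible f g G h k `<=` Q_feasible f g G h k'.
Proof.
move=> kk' mu [s0 [s1 [t [e sosP d0 d1 d2]]]]; exists s0, s1, t.
have up p : deg_le p (2 * k)%N -> deg_le p (2 * k')%N.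
  by move=> /leq_trans; apply; rewrite ltnS leq_mul2l.
by split => // [|p|q]; apply: up.
Qed.

Lemma val_Q_mono (R : realType) (n m s r : nat) (f : {mpoly R[n + m]})
    (g : 'I_s -> {mpoly R[n + m]}) (G : {mpoly R[n + m]})
    (h : 'I_r -> {mpoly R[m]}) (k k' : nat) :
  (k <= k')%N -> (val_Q f g G h k <= val_Q f g G h k')%E.
Proof.
by move=> kk'; apply/ereal_sup_le/image_subset/Q_feasible_mono.
Qed.

(** A feasible point has Fritz John multipliers, and at the resulting point of the
    extended space the certificate shows f >= mu. *)
Lemma val_Q_le (R : realType) (n m s r : nat) (f : {mpoly R[n + m]})
    (g : 'I_s -> {mpoly R[n + m]}) (G : {mpoly R[n + m]})
    (h : 'I_r -> {mpoly R[m]}) (k : nat) :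
  (val_Q f g G h k <= val_P f g G h)%E.
Proof.
apply/ereal_infP => _ [[x y] [gxy ysol] <-]; apply/ereal_supP => v [mu + <-].
move=> [s0 [s1 [t [e [s0P s1P] _ _ _]]]]; rewrite lee_fin /=.
have [l fj] := fritz_john_necessary ysol.
pose lv : 'rV[R]_r.+1 := \row_j l j; pose z := row_mx (row_mx x y) lv.
have lvE : lv ord0 = l by apply/funext => j; rewrite mxE.
have [Gz Hz] : (forall p, peval (Ghat g h p) z <= 0) /\
    (forall q, peval (Hhat G h q) z = 0).
  by apply/hat_system; rewrite lvE; split => //; case: ysol.
have := congr1 (fun p => peval p z) e.
rewrite /peval !mevalB mevalC -!/(peval _ _) peval_of_xy !peval_sum => efz.
rewrite -subr_ge0 efz [X in _ - X]big1 ?subr0 => [|q _]; last first.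
  by rewrite /peval mevalM -!/(peval _ _) Hz mulr0.
rewrite subr_ge0 (@le_trans _ _ 0) ?peval_sos // sumr_le0 // => p _.
by rewrite /peval mevalM -!/(peval _ _) mulr_ge0_le0 // peval_sos.
Qed.

Lemma Q_feasible_of_generated (R : realType) (n m s r : nat) (f : {mpoly R[n + m]})
    (g : 'I_s -> {mpoly R[n + m]}) (G : {mpoly R[n + m]})
    (h : 'I_r -> {mpoly R[m]}) (mu : R) :
  generated_qm (Ghat g h) (Hhat G h) (of_xy r f - mpolyC (n + m + r.+1) mu) ->
  exists k, Q_feasible f g G h k mu.
Proof.
move=> [s0 [s1 [t [e s0P s1P]]]].
pose deg (p : {mpoly R[n + m + r.+1]}) := mmeasure mdeg p.
pose k := (deg s0 + \sum_p deg (s1 p * Ghat g h p)%R + \sum_q deg (t q * Hhat G h q)%R)%N.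
have up (p : {mpoly R[n + m + r.+1]}) : (deg p <= k)%N -> deg_le p (2 * k)%N.
  by move=> /leq_trans; apply; rewrite mul2n -addnn leqW // leq_addr.
exists k, s0, s1, t; split => // [|p|q]; apply: up.
- by rewrite /k -addnA leq_addr.
- apply: leq_trans (leq_addr _ _); apply: leq_trans (leq_addl _ _).
  by rewrite (bigD1 p) //= leq_addr.
- by apply: leq_trans (leq_addl _ _); rewrite (bigD1 q) //= leq_addr.
Qed.

Lemma sos_rename (R : realType) (n k : nat) (e : 'I_n -> 'I_k) (p : {mpoly R[n]}) :
  sos p -> sos (rename e p).
Proof.
move=> [u ->]; exists [seq rename e q | q <- u]; rewrite big_map /rename raddf_sum.
by apply: eq_bigr => q _; rewrite /= rmorphXn.
Qed.

Lemma rename_mvar (R : realType) (n k : nat) (e : 'I_n -> 'I_k) (i : 'I_n) :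
  rename e (mvar R i) = mvar R (e i).
Proof. by rewrite /rename comp_mpolyXU -tnth_nth tnth_mktuple. Qed.

(** The bound on (x, y) comes from the constraints g, and the one on lambda from
    the last equation, which puts lambda on the unit sphere. *)
Lemma hat_archimedean (R : realType) (n m s r : nat) (g : 'I_s -> {mpoly R[n + m]})
    (G : {mpoly R[n + m]}) (h : 'I_r -> {mpoly R[m]}) (c : R)
    (sigma0 : {mpoly R[n + m]}) (sigma : 'I_s -> {mpoly R[n + m]}) :
  sos sigma0 -> (forall i, sos (sigma i)) ->
  mpolyC (n + m) c - sqnorm R (n + m) = sigma0 - \sum_(i < s) sigma i * g i ->
  generated_qm (Ghat g h) (Hhat G h)
    (mpolyC (n + m + r.+1) (c + 1) - sqnorm R (n + m + r.+1)).
Proof.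
move=> s0P sP e.
have [Q1 QD QM] := generated_quadratic_module (Ghat g h) (Hhat G h).
have -> : mpolyC (n + m + r.+1) (c + 1) - sqnorm R (n + m + r.+1) =
    of_xy r sigma0 + \sum_i - (of_xy r (sigma i) * Ghat g h (lshift r.+1 (lshift r i)))
    + -1 * Hhat G h (rshift (r + m) ord0).
  transitivity (of_xy r (mpolyC (n + m) c - sqnorm R (n + m)) + 1
                - \sum_(j < r.+1) lambda R n m j ^+ 2).
    rewrite /of_xy {1}/rename comp_mpolyB comp_mpolyC mpolyCD mpolyC1.
    rewrite {1}/sqnorm big_split_ord /= opprD addrA; congr (_ - _).
    rewrite [RHS]addrAC; congr (_ - _).
    rewrite /sqnorm raddf_sum; apply: eq_bigr => i _.
    by rewrite /= rmorphXn /= -/(rename _ _) rename_mvar.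
  rewrite e Hhat_sphere mulN1r opprB addrA; congr (_ + _ - _).
  rewrite /of_xy /rename comp_mpolyB sumrN (raddf_sum (comp_mpoly _)); congr (_ - _).
  by apply: eq_bigr => i _; rewrite /= rmorphM /= -/(rename _ _) Ghat_upper.
apply: (QD); last exact: generated_qm_eq.
apply: (QD); first exact/generated_qm_sos/sos_rename.
elim/big_ind: _ => [||i _]; [exact/generated_qm_sos/sos0 | exact: QD |].
exact/generated_qm_ineq/sos_rename.
Qed.

Theorem theorem3p5 (R : realType) (n m s r : nat)
    (f : {mpoly R[n + m]}) (g : 'I_s -> {mpoly R[n + m]})
    (G : {mpoly R[n + m]}) (h : 'I_r -> {mpoly R[m]})
    (feasible_nonempty : bilevel_feasible g G h !=set0)
    (lower_level_convex : lower_convex G h)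
    (representations : exists (R1 R2 : R) (sigma0 : {mpoly R[n + m]})
        (sigma : 'I_s -> {mpoly R[n + m]}) (tau0 : {mpoly R[m]})
        (tau : 'I_r -> {mpoly R[m]}),
      [/\ 0 < R1 /\ 0 < R2,
          sos sigma0 /\ (forall i, sos (sigma i)),
          sos tau0 /\ (forall j, sos (tau j)),
          mpolyC (n + m) R1 - sqnorm R (n + m) =
            sigma0 - \sum_(i < s) sigma i * g i &
          mpolyC m R2 - sqnorm R m = tau0 - \sum_(j < r) tau j * h j])
    (nondegeneracy : nondegeneracy_condition h)
    (slater : slater_condition h) :
  (forall k : nat, (val_Q f g G h k <= val_Q f g G h k.+1)%E) /\
  val_Q f g G h @ \oo --> val_P f g G h.
Proof.
split; first by move=> k; apply: val_Q_mono.
suff valE : ereal_sup (range (val_Q f g G h)) = val_P f g G h.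
  rewrite -valE; apply: ereal_nondecreasing_cvgn => k k'; exact: val_Q_mono.
apply: le_anti; apply/andP; split.
  by apply/ereal_supP => _ [k _ <-]; apply: val_Q_le.
have [R1 [R2 [sigma0 [sigma [tau0 [tau [_ [s0P sP] _ e _]]]]]]] := representations.
have feas (mu : R) : (mu%:E < val_P f g G h)%E -> exists k, Q_feasible f g G h k mu.
  move=> mulP; apply: Q_feasible_of_generated.
  apply: putinar (hat_archimedean G h s0P sP e) _ => v.
  rewrite -(hsubmxK v) -(hsubmxK (lsubmx v)).
  set x := lsubmx (lsubmx v); set y := rsubmx (lsubmx v) => Gv Hv.
  have /hat_system[gz hz fj] := conj Gv Hv.
  rewrite /peval mevalB mevalC -/(peval _ _) peval_of_xy subr_gt0 -lte_fin.
  apply: lt_le_trans mulP _; apply: ereal_inf_lbound; exists (x, y) => //; split => //.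
  exact: fritz_john_sufficient fj.
case vP: (val_P f g G h) feas => [v||] feas; last by rewrite leNye.
  apply/lee_addgt0Pr => d d0; have [|k muk] := feas (v - d).
    by rewrite lte_fin ltrBlDr ltrDl.
  rewrite -leeBlDr // -EFinB.
  apply: le_trans (ereal_sup_ubound _); last by exists k.
  by apply: ereal_sup_ubound; exists (v - d).
have [z zP] := feasible_nonempty.
have : (val_P f g G h <= (peval f (row_mx z.1 z.2))%:E)%E.
  by apply: ereal_inf_lbound; exists z.
by rewrite vP leye_eq.
Qed.
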